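(* For a complex matrix $A=(A(k,l))_{k,l\in\mathbb{Z}}$ let $A_N$ be the banded approximation of $A$ of width $N$, defined by $A_N(k,l)=A(k,l)$ for $|k-l|\le N$ and $A_N(k,l)=0$ otherwise. If $A$ is invertible on $\ell^2(\mathbb{Z})$ and for some constants $r,C>0$ $$\|A-A_N\|_{\ell^2\to\ell^2}\le C N^{-r}\qquad\text{for all } N>0,$$ then there exist a constant $C'>0$ and a sequence $(B_N)$ of banded matrices, $B_N$ of width $N$, such that $$\|A^{-1}-B_N\|_{\ell^2\to\ell^2}\le C' N^{-r}\qquad\text{for all } N>0.$$
   Context: $N$ ranges over the positive integers. A matrix $B$ over $\mathbb{Z}$ is banded of width $N$ if $B(k,l)=0$ whenever $|k-l|>N$. Matrices are identified with the operators they induce on $\ell^2(\mathbb{Z})$; ''invertible on $\ell^2(\mathbb{Z})$'' means bounded with bounded inverse on $\ell^2(\mathbb{Z})$. $\|\cdot\|_{\ell^2\to\ell^2}$ is the operator norm. *)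

(* Defs.v *)
From mathcomp Require Import all_boot all_order all_algebra.
From mathcomp Require Import all_classical all_reals all_analysis.
From mathcomp Require Import complex.
(* Not imported: its [summable] would shadow the one of [esum]. *)
From mathcomp Require summability.

Set Implicit Arguments.
Unset Strict Implicit.
Unset Printing Implicit Defensive.

Import Order.TTheory GRing.Theory Num.Theory.
Import numFieldNormedType.Exports.

Local Open Scope classical_set_scope.
Local Open Scope ring_scope.

Section Defs.
Variable R : realType.

Definition zseq := int -> R[i].
Definition zmatrix := int -> int -> R[i].

(* ||x||_2 in [0, +oo]; it is +oo exactly when x is not square-summable.
   [Normc.normc] is the modulus with values in R (while `|z| lies in R[i]). *)
Definition l2norm (x : zseq) : \bar R :=
  sqrte (\esum_(k in [set: int]) (Normc.normc (x k) ^+ 2)%:E).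

Definition l2 : set zseq := [set x | (l2norm x < +oo)%E].

(* Operators on l2 are total maps on sequences of which only the values on l2
   matter. *)
Definition opnorm (T : zseq -> zseq) : \bar R :=
  ereal_sup [set l2norm (T x) | x in [set x | (l2norm x <= 1)%E]].

Definition linear_on_l2 (T : zseq -> zseq) : Prop :=
  forall (a : R[i]) (x y : zseq), l2 x -> l2 y ->
    T (fun k => a * x k + y k) = (fun k => a * T x k + T y k).

Definition bounded_operator (T : zseq -> zseq) : Prop :=
  [/\ forall x, l2 x -> l2 (T x), linear_on_l2 T & (opnorm T < +oo)%E].

(* The terms of the series (A x)(k) = \sum_l A(k,l) x(l).  The series is summed
   unconditionally, over the net of finite subsets of int; R[i]^o carries the
   topology of the modulus. *)
Definition mxterm (A : zmatrix) (x : zseq) (k : int) : int -> R[i]^o :=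
  fun l => A k l * x l.

Definition mxop (A : zmatrix) (x : zseq) : zseq :=
  fun k => summability.sum (mxterm A x k).

(* The convergence clause is needed because [summability.sum] is a total
   function, with an arbitrary value on divergent families. *)
Definition bounded_matrix (A : zmatrix) : Prop :=
  (forall x, l2 x -> forall k,
     cvg (summability.partial_sum (mxterm A x k) @ summability.totally))
  /\ bounded_operator (mxop A).

(* A is invertible on l2 with inverse T; T is unique as an operator on l2. *)
Definition l2_inverse (A : zmatrix) (T : zseq -> zseq) : Prop :=
  [/\ bounded_matrix A, bounded_operator T,
      forall x, l2 x -> T (mxop A x) = x
    & forall x, l2 x -> mxop A (T x) = x].

Definition banded (N : nat) (B : zmatrix) : Prop :=
  forall k l : int, (N < `|k - l|)%N -> B k l = 0.

Definition band (N : nat) (A : zmatrix) : zmatrix :=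
  fun k l => if (`|k - l| <= N)%N then A k l else 0.

End Defs.

(* Main.v *)
Require Import Defs.
From mathcomp Require Import all_boot all_order all_algebra finmap.
From mathcomp Require Import all_classical all_reals all_analysis.
From mathcomp Require Import complex.
From mathcomp Require Import ring lra zify.
Import Order.TTheory GRing.Theory Num.Theory.
Local Open Scope ring_scope.

(* Write [S] for the inverse of [A] and [A_M] for the band of width [M].  A
   banded [B] close enough to [A] is bounded below, and the partial Neumann sums
   for [(B^*B)^-1 B^*] are banded; they yield a banded [D], of width [n] say,
   with [|1 - D A| <= eta] for [eta] as small as desired.  Since
   [S = D + (1 - D A) S], a banded approximation [X] of [S] of width [M] and
   error [e] gives the approximation [D + (1 - D A_M) X] of width [n + 2M] and
   error at most [eta e + 2 |D| |S| |A - A_M|].  As [eta] can be chosen below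
   [4^-r / 2], the bound [e = O(M^-r)] propagates from [M] to [N ~ 2M].
   Norm estimates on banded operators are computed on finitely supported
   sequences, where all sums are finite. *)

Section BandedInverse.
Variable R : realType.
Set Implicit Arguments.
Unset Strict Implicit.
Implicit Types (x y : zseq R) (s t : seq int) (B D : zmatrix R).
Local Notation normc := Normc.normc.
Local Notation Re := (@complex.Re R).

(** * Finite square sums and norm bounds on sequences *)

Lemma big_uniq_support (V : nmodType) (F : int -> V) s t :
  uniq s -> uniq t -> (forall k, k \notin s -> F k = 0) ->
  (forall k, k \notin t -> F k = 0) ->
  \sum_(k <- s) F k = \sum_(k <- t) F k.
Proof.
move=> us ut Fs Ft.
have H (p q : seq int) : (forall k, k \notin q -> F k = 0) ->
    \sum_(k <- p) F k = \sum_(k <- p | k \in q) F k.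
  move=> Fq; rewrite [LHS](bigID (fun k => k \in q)) /= [X in _ + X]big1 ?addr0 //.
rewrite (H s t Ft) (H t s Fs) -!(big_filter _ (fun k => k \in _)).
apply: perm_big; apply: uniq_perm; rewrite ?filter_uniq // => k.
by rewrite !mem_filter andbC.
Qed.

Definition sqs s x : R := \sum_(k <- s) normc (x k) ^+ 2.

(** The norm bound is tested on finite sums with a real constant, so that no extended real appears;
    for [0 <= a] it amounts to [l2norm x <= a] ([l2normP]). *)
Definition l2_le x (a : R) := forall s, uniq s -> sqs s x <= a ^+ 2.

Definition supp s x := forall k, k \notin s -> x k = 0.

Lemma normc_ge0 (z : R[i]) : 0 <= normc z.
Proof. by case: z => u v; exact: sqrtr_ge0. Qed.

Lemma sqs_ge0 s x : 0 <= sqs s x.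
Proof. by apply: sumr_ge0 => k _; exact: sqr_ge0. Qed.

Lemma normc0 : normc (0 : R[i]) = 0.
Proof. exact: Normc.normc0. Qed.

Lemma sqs_supp s t x : uniq s -> uniq t -> supp s x -> supp t x ->
  sqs s x = sqs t x.
Proof.
move=> us ut xs xt; apply: big_uniq_support => // k ks.
  by rewrite xs // normc0 expr0n.
by rewrite xt // normc0 expr0n.
Qed.

Lemma sqs_subset s t x : uniq s -> uniq t -> {subset s <= t} ->
  sqs s x <= sqs t x.
Proof.
move=> us ut st; rewrite /sqs [leRHS](bigID (fun k => k \in s)) /=.
have -> : \sum_(k <- s) normc (x k) ^+ 2 =
    \sum_(k <- t | k \in s) normc (x k) ^+ 2.
  rewrite -[RHS]big_filter; apply: perm_big; apply: uniq_perm => //.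
    by rewrite filter_uniq.
  by move=> k; rewrite mem_filter; case ks: (k \in s) => //=; rewrite (st _ ks).
by rewrite lerDl; apply: sumr_ge0 => k _; exact: sqr_ge0.
Qed.

Lemma sqs_le_supp s t x : uniq s -> uniq t -> supp s x -> sqs t x <= sqs s x.
Proof.
move=> us ut xs; set u := undup (s ++ t).
have xu : supp u x.
  by move=> k; rewrite mem_undup mem_cat negb_or => /andP[/xs].
rewrite (@sqs_supp s u) ?undup_uniq //; apply: sqs_subset; rewrite ?undup_uniq //.
by move=> k kt; rewrite mem_undup mem_cat kt orbT.
Qed.

Lemma l2_le_supp s x : uniq s -> supp s x -> l2_le x (Num.sqrt (sqs s x)).
Proof. by move=> us xs t ut; rewrite sqr_sqrtr ?sqs_ge0 // sqs_le_supp. Qed.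

Lemma l2_leW x (a b : R) : 0 <= a -> a <= b -> l2_le x a -> l2_le x b.
Proof.
move=> a0 ab xa s us; apply: le_trans (xa s us) _.
by rewrite lerXn2r // nnegrE ?(le_trans a0).
Qed.

Lemma l2_le0 x : l2_le x 0 -> x = fun=> 0.
Proof.
move=> x0; apply/funext => k; have := x0 [:: k] isT.
rewrite /sqs big_seq1 expr0n /= => H; apply: Normc.eq0_normc.
by apply/eqP; rewrite -sqrf_eq0 eq_le H sqr_ge0.
Qed.

Lemma l2_le_cst0 (a : R) : l2_le (fun=> 0) a.
Proof. by move=> s _; rewrite /sqs big1 ?sqr_ge0// => k _; rewrite normc0 expr0n. Qed.

(** Minkowski's inequality without Cauchy-Schwarz: termwise [(u + v)^2 <= (1 + b/a) u^2 + (1 + a/b)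
    v^2], and with these weights the right side sums to at most [(a + b)^2]. A zero bound forces a
    zero sequence and is treated apart. *)
Lemma l2_leD x y (a b : R) : 0 <= a -> 0 <= b -> l2_le x a -> l2_le y b ->
  l2_le (fun k => x k + y k) (a + b).
Proof.
move=> a0 b0; move: (a0); rewrite le_eqVlt => /predU1P[<- /l2_le0 -> yb|ap xa].
  by rewrite add0r; under eq_fun do rewrite add0r.
move: (b0) xa; rewrite le_eqVlt => /predU1P[<- xa /l2_le0 ->|bp xa yb].
  by rewrite addr0; under eq_fun do rewrite addr0.
move=> s us; rewrite /sqs.
have H k : normc (x k + y k) ^+ 2 <=
    (1 + b / a) * normc (x k) ^+ 2 + (1 + a / b) * normc (y k) ^+ 2.
  have := @le_normcD R (x k) (y k); set u := normc (x k); set v := normc (y k).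
  move=> uv; apply: (@le_trans _ _ ((u + v) ^+ 2)).
    by rewrite lerXn2r // nnegrE ?addr_ge0 ?normc_ge0.
  rewrite -subr_ge0.
  have -> : (1 + b / a) * u ^+ 2 + (1 + a / b) * v ^+ 2 - (u + v) ^+ 2 =
     (b * u - a * v) ^+ 2 / (a * b).
    by field; rewrite !gt_eqF.
  by rewrite divr_ge0 ?sqr_ge0 // mulr_ge0.
apply: (le_trans (ler_sum _ (fun k _ => H k))).
rewrite big_split /= -!mulr_sumr.
have -> : (a + b) ^+ 2 = (1 + b / a) * a ^+ 2 + (1 + a / b) * b ^+ 2.
  by field; rewrite !gt_eqF.
by rewrite lerD // ler_wpM2l ?addr_ge0 ?divr_ge0 //; [exact: xa|exact: yb].
Qed.

Lemma l2_leZ (c : R[i]) x (a : R) : l2_le x a ->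
  l2_le (fun k => c * x k) (normc c * a).
Proof.
move=> xa s us; rewrite /sqs.
under eq_bigr do rewrite Normc.normcM exprMn.
by rewrite -mulr_sumr exprMn ler_wpM2l ?sqr_ge0 ?xa.
Qed.

Lemma normc_real (c : R) : 0 <= c -> normc (c%:C)%C = c.
Proof. by move=> c0; rewrite /= expr0n addr0 sqrtr_sqr ger0_norm. Qed.

Lemma l2_leN x (a : R) : l2_le x a -> l2_le (fun k => - x k) a.
Proof.
by move=> xa s us; rewrite /sqs; under eq_bigr do rewrite normcN; exact: xa.
Qed.

Lemma l2_leB x y (a b : R) : 0 <= a -> 0 <= b -> l2_le x a -> l2_le y b ->
  l2_le (fun k => x k - y k) (a + b).
Proof. by move=> a0 b0 xa /l2_leN; exact: l2_leD. Qed.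

Lemma l2normP x (a : R) : 0 <= a -> (l2norm x <= a%:E)%E <-> l2_le x a.
Proof.
move=> a0; have -> : (a%:E = sqrte (a ^+ 2)%:E)%E.
  by rewrite /sqrte sqrtr_sqr ger0_norm.
rewrite /l2norm lee_sqrt ?lee_fin ?sqr_ge0 //; split => [H s us|H].
  rewrite -lee_fin; apply: le_trans H; apply: ereal_sup_ubound.
  exists [set` s]%classic; first by split => //; exact: finite_seq.
  by rewrite -fsbig_seq //= /sqs sumEFin.
apply: ge_ereal_sup => _ [F [Ffin _] <-].
rewrite fsbig_finite //= sumEFin lee_fin.
by apply: H; exact: fset_uniq.
Qed.

Lemma l2P x : l2 x <-> exists2 a : R, 0 <= a & l2_le x a.
Proof.
split=> [|[a a0 /l2normP xa]]; last first.
  by apply: le_lt_trans (xa a0) _; rewrite ltry.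
rewrite /l2 /=; case E: (l2norm x) => [a| |] // _; last first.
  by exists 0 => //; apply/l2normP; rewrite ?E ?leNye.
exists `|a| => //; apply/l2normP; rewrite ?E ?lee_fin //; exact: ler_norm.
Qed.

(** * Bounds on operators *)

Definition op_le (c : R) (T : zseq R -> zseq R) :=
  forall x a, 0 <= a -> l2_le x a -> l2_le (T x) (c * a).

Lemma op_leW (c d : R) T : 0 <= c -> c <= d -> op_le c T -> op_le d T.
Proof.
move=> c0 cd H x a a0 xa; apply: (l2_leW _ _ (H x a a0 xa)).
  exact: mulr_ge0.
exact: ler_wpM2r.
Qed.

(** Homogeneity carries the bound from the unit ball to [x = a y]. For [a = 0], the value [T 0 = 0]
    comes from linearity applied to [0 = 1 * 0 + 0]. *)
Lemma opnorm_op_le (c : R) T : linear_on_l2 T -> 0 <= c ->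
  (opnorm T <= c%:E)%E -> op_le c T.
Proof.
move=> Tlin c0 Tc.
have l20 : l2 (fun=> 0 : R[i]) by apply/l2P; exists 0 => //; exact: l2_le_cst0.
have T0 : T (fun=> 0) = fun=> 0.
  have := Tlin 1 _ _ l20 l20; rewrite mul1r addr0 => H.
  apply/funext => k; move: (congr1 (@^~ k) H) => /= /esym.
  by rewrite mul1r -[RHS]add0r => /addIr.
move=> x a; rewrite le_eqVlt => /predU1P[<- /l2_le0 ->|a0 xa].
  by rewrite T0; exact: l2_le_cst0.
pose y : zseq R := fun k => (a^-1%:C)%C * x k.
have y1 : l2_le y 1.
  have := @l2_leZ (a^-1%:C)%C _ _ xa.
  by rewrite normc_real ?invr_ge0 ?ltW // mulVf ?gt_eqF.
have yl2 : l2 y by apply/l2P; exists 1.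
have xE : x = fun k => (a%:C)%C * y k + (fun=> 0) k.
  apply/funext => k; rewrite /y addr0 mulrA -rmorphM mulfV ?gt_eqF //.
  by rewrite rmorph1 mul1r.
rewrite xE Tlin // T0; under eq_fun do rewrite addr0.
have Ty : l2_le (T y) c.
  apply/l2normP => //; apply: le_trans Tc; apply: ereal_sup_ubound.
  by exists y => //=; apply/l2normP.
by have := @l2_leZ (a%:C)%C _ _ Ty; rewrite normc_real ?ltW // mulrC.
Qed.

Lemma op_le_opnorm (c : R) T : 0 <= c -> op_le c T -> (opnorm T <= c%:E)%E.
Proof.
move=> c0 Tc; apply: ge_ereal_sup => _ [x /= x1 <-]; apply/l2normP => //.
by rewrite -[c]mulr1; apply: Tc => //; apply/l2normP.
Qed.

(** The norm is replaced by its maximum with 1, so that the constant can be inverted. *)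
Lemma bounded_operator_op_le T : bounded_operator T ->
  exists2 c : R, 1 <= c & op_le c T.
Proof.
move=> [_ Tlin Tfin]; exists (Num.max 1 (fine (opnorm T))).
  by rewrite le_max lexx.
have c0 : 0 <= Num.max 1 (fine (opnorm T)) by rewrite le_max ler01.
apply: opnorm_op_le => //; case: (opnorm T) Tfin => [u| |] //= _.
  by rewrite lee_fin le_max lexx orbT.
by move=> *; exact: leNye.
Qed.

(* Matrix series with finitely many nonzero terms *)
#[local] Existing Instance summability.totally_filter.

Lemma partial_sum_support (f : int -> R[i]^o) s : uniq s ->
  (forall l, l \notin s -> f l = 0) ->
  \forall F \near summability.totally,
    summability.partial_sum f F = \sum_(l <- s) f l.
Proof.
move=> us fs; exists [fset l in s]%fset => // F /= sF.
rewrite /summability.partial_sum -(big_seq_fsetE _ F xpredT f) /=.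
apply: big_uniq_support => //; first exact: fset_uniq.
move=> k kF; apply: fs; apply: contra kF => ks; apply: (fsubsetP sF).
by rewrite inE.
Qed.

Lemma mxop_support B x k s : uniq s ->
  (forall l, l \notin s -> B k l * x l = 0) ->
  mxop B x k = \sum_(l <- s) B k l * x l.
Proof.
move=> us Bs; apply: (@norm_lim_near_cst R[i] (R[i]^o)).
exact: (@partial_sum_support (mxterm B x k)).
Qed.

(** The sum of a family is a total function, so subtracting sums requires both nets to converge:
    that of [A] by assumption, that of [B] because it is eventually constant. *)
Lemma mxop_sub A B x k s : uniq s ->
  (forall l, l \notin s -> B k l * x l = 0) ->
  cvg (summability.partial_sum (mxterm A x k) @ summability.totally)%classic ->
  mxop (fun i j => A i j - B i j) x k = mxop A x k - mxop B x k.
Proof.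
move=> us Bs Acv; have E := mxop_support us Bs.
rewrite [X in _ - X]E {E}.
apply: (@cvg_lim (R[i]^o)); first exact: (@norm_hausdorff R[i] (R[i]^o)).
have -> : summability.partial_sum (mxterm (fun i j => A i j - B i j) x k) =
   (fun F => summability.partial_sum (mxterm A x k) F -
             summability.partial_sum (mxterm B x k) F).
  apply/funext => F; rewrite /summability.partial_sum -sumrB.
  by apply: eq_bigr => i _; rewrite /mxterm mulrBl.
apply: cvgB; first exact: Acv.
apply: cvg_near_cst; exact: (partial_sum_support (f := mxterm B x k) us Bs).
Qed.

(** * Banded matrices as operators *)

(** The [N]-neighbourhood of [s] as a list without repetition; the offsets run over [[-N, N]]. *)
Definition fatten (N : nat) s : seq int :=
  undup [seq k + (i%:Z - N%:Z) | k <- s, i <- iota 0 (2 * N).+1].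

Lemma fatten_uniq N s : uniq (fatten N s).
Proof. exact: undup_uniq. Qed.

Lemma mem_fatten N s (k l : int) : k \in s -> (`|k - l| <= N)%N -> l \in fatten N s.
Proof.
move=> ks kl; rewrite mem_undup; apply/allpairsP.
exists (k, absz (l - k + N%:Z)); split => //; last by rewrite /=; lia.
by rewrite mem_iota /=; lia.
Qed.

Lemma banded_fatten N B s (k l : int) : banded N B -> k \in s ->
  l \notin fatten N s -> B k l = 0.
Proof.
move=> BN ks lN; apply: BN; rewrite ltnNge; apply: contra lN; exact: mem_fatten.
Qed.

Lemma banded_fattenC N B s (k l : int) : banded N B -> l \in s ->
  k \notin fatten N s -> B k l = 0.
Proof.
move=> BN ls kN; apply: BN; rewrite ltnNge; apply: contra kN => kl.
by apply: (mem_fatten ls); rewrite distnC.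
Qed.

Lemma mxop_fatten N B x s k : banded N B -> k \in s ->
  mxop B x k = \sum_(l <- fatten N s) B k l * x l.
Proof.
move=> BN ks; apply: mxop_support => [|l lN]; first exact: fatten_uniq.
by rewrite (banded_fatten BN ks lN) mul0r.
Qed.

Lemma mxop_supp B x s k : uniq s -> supp s x ->
  mxop B x k = \sum_(l <- s) B k l * x l.
Proof. by move=> us xs; apply: mxop_support => // l /xs ->; rewrite mulr0. Qed.

Lemma mxop_eq0 B x k : (forall l, B k l * x l = 0) -> mxop B x k = 0.
Proof. by move=> H; rewrite (@mxop_support B x k [::]) ?big_nil. Qed.

Lemma supp_mxop N B x s : banded N B -> supp s x -> supp (fatten N s) (mxop B x).
Proof.
move=> BN xs k kN; apply: mxop_eq0 => l.
have [ls|/xs ->] := boolP (l \in s); last by rewrite mulr0.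
by rewrite (banded_fattenC BN ls kN) mul0r.
Qed.

(** Each row of a banded matrix is finite, so linearity holds on all sequences and not only on
    l2. *)
Lemma banded_mxopP N B (a : R[i]) x y : banded N B ->
  mxop B (fun k => a * x k + y k) = fun k => a * mxop B x k + mxop B y k.
Proof.
move=> BN; apply/funext => k; have kk := mem_head k [::].
rewrite !(mxop_fatten _ BN kk) mulr_sumr -big_split /=.
by apply: eq_bigr => l _; ring.
Qed.

(** Bandedness is stated for operators, as an equality on all sequences, so that sums and composites
    can be written as functions without naming their matrices. *)
Definition band_op (N : nat) (T : zseq R -> zseq R) :=
  exists2 B, banded N B & T = mxop B.

Lemma band_op_linear N T (a : R[i]) x y : band_op N T ->
  T (fun k => a * x k + y k) = fun k => a * T x k + T y k.
Proof. by move=> [B BN ->]; exact: banded_mxopP BN. Qed.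

Lemma band_op_sub N T x y : band_op N T ->
  T (fun k => x k - y k) = fun k => T x k - T y k.
Proof.
move=> TN.
have -> : (fun k => x k - y k) = (fun k => -1 * y k + x k).
  by apply/funext => k; ring.
by rewrite (band_op_linear _ _ _ TN); apply/funext => k; ring.
Qed.

Lemma band_opW N M T : (N <= M)%N -> band_op N T -> band_op M T.
Proof.
by move=> NM [B BN ->]; exists B => // k l kl; apply: BN; exact: leq_ltn_trans kl.
Qed.

Lemma band_op_axpy N T S (a : R[i]) : band_op N T -> band_op N S ->
  band_op N (fun x k => a * T x k + S x k).
Proof.
move=> [B BN ->] [D DN ->]; exists (fun k l => a * B k l + D k l).
  by move=> k l kl; rewrite BN // DN // mulr0 addr0.
apply/funext => x; apply/funext => k; have kk := mem_head k [::].
rewrite (mxop_fatten _ BN kk) (mxop_fatten _ DN kk).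
rewrite (@mxop_support _ _ _ (fatten N [:: k])) ?fatten_uniq //.
  by rewrite mulr_sumr -big_split /=; apply: eq_bigr => l _; ring.
by move=> l lN; rewrite (banded_fatten BN kk lN) (banded_fatten DN kk lN) mulr0 addr0 mul0r.
Qed.

Lemma band_op_id : band_op 0 id.
Proof.
exists (fun k l => (k == l)%:R).
  by move=> k l kl; rewrite (_ : k == l = false) //; apply/negbTE; lia.
apply/funext => x; apply/funext => k; rewrite (@mxop_support _ _ _ [:: k]) //.
  by rewrite big_seq1 eqxx mul1r.
by move=> l; rewrite inE eq_sym => /negbTE ->; rewrite mul0r.
Qed.

(** The matrix is the product [B D], whose column [l] is [B] applied to column [l] of [D]. If
    [|k - l| > N + M], every [j] has [|k - j| > N] or [|j - l| > M]. *)
Lemma band_op_comp N M T S : band_op N T -> band_op M S ->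
  band_op (N + M) (fun x => T (S x)).
Proof.
move=> [B BN ->] [D DM ->]; exists (fun k l => mxop B (fun j => D j l) k).
  move=> k l kl; apply: mxop_eq0 => j.
  have [kj|kj] := ltnP N `|k - j|; first by rewrite BN // mul0r.
  by rewrite DM ?mulr0 //; lia.
apply/funext => x; apply/funext => k; have kk := mem_head k [::].
rewrite (mxop_fatten _ BN kk).
rewrite (@mxop_support (fun i l => mxop B (fun j => D j l) i) _ _
  (fatten (N + M) [:: k])) ?fatten_uniq //; last first.
  move=> l lN; rewrite mxop_eq0 ?mul0r // => j.
  have [kj|kj] := ltnP N `|k - j|; first by rewrite BN // mul0r.
  rewrite (DM j l) ?mulr0 // ltnNge; apply: contra lN => jl.
  by apply: (mem_fatten kk); lia.
under [RHS]eq_bigr => l _ do rewrite (mxop_fatten _ BN kk) mulr_suml.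
rewrite exchange_big /=; apply: eq_bigr => j _.
have [kj|kj] := ltnP N `|k - j|.
  by rewrite BN // mul0r big1 // => l _; rewrite mul0r mul0r.
rewrite (@mxop_support D x j (fatten (N + M) [:: k])) ?fatten_uniq //.
  by rewrite mulr_sumr; apply: eq_bigr => l _; rewrite mulrA.
move=> l lN; rewrite DM ?mul0r // ltnNge; apply: contra lN => jl.
by apply: (mem_fatten kk); lia.
Qed.

(** On [s] the value [T x] depends only on [x] over [fatten N s]; cutting [x] off outside this
    window reduces the bound to finitely supported sequences. *)
Lemma band_op_le_supp N T (c : R) : 0 <= c -> band_op N T ->
  (forall s x, uniq s -> supp s x ->
     sqs (fatten N s) (T x) <= c ^+ 2 * sqs s x) -> op_le c T.
Proof.
move=> c0 [B BN ->] H x a a0 xa s us; set t := fatten N s.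
have ut : uniq t := fatten_uniq N s.
pose y : zseq R := fun k => if k \in t then x k else 0.
have yt : supp t y by move=> k /negbTE kt; rewrite /y kt.
have -> : sqs s (mxop B x) = sqs s (mxop B y).
  rewrite /sqs !big_seq; apply: eq_bigr => k ks; congr (normc _ ^+ 2).
  rewrite !(mxop_fatten _ BN ks) !big_seq; apply: eq_bigr => l lt.
  by rewrite /y lt.
apply: (@le_trans _ _ (sqs (fatten N t) (mxop B y))).
  by apply: sqs_le_supp => //; [exact: fatten_uniq|exact: supp_mxop].
apply: (le_trans (H _ _ ut yt)); rewrite exprMn ler_wpM2l ?sqr_ge0 //.
have -> : sqs t y = sqs t x.
  by rewrite /sqs !big_seq; apply: eq_bigr => k kt; rewrite /y kt.
exact: xa.
Qed.

(** * Adjoints of banded matrices *)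

Definition ip s x y : R[i] := \sum_(k <- s) x k * (y k)^*%C.

Definition adjmx B : zmatrix R := fun k l => (B l k)^*%C.

Lemma adjmx_banded N B : banded N B -> banded N (adjmx B).
Proof. by move=> BN k l kl; rewrite /adjmx BN ?rmorph0 // distnC. Qed.

Lemma Re_ip s x y : Re (ip s x y) = \sum_(k <- s) Re (x k * (y k)^*%C).
Proof. by rewrite /ip raddf_sum. Qed.

Lemma sqr_normcE (z : R[i]) : normc z ^+ 2 = Re (z * z^*%C).
Proof.
case: z => u v /=; rewrite sqr_sqrtr ?addr_ge0 ?sqr_ge0 //; ring.
Qed.

Lemma Re_ipxx s x : Re (ip s x x) = sqs s x.
Proof. by rewrite Re_ip; apply: eq_bigr => k _; rewrite sqr_normcE. Qed.

Lemma ip_supp s t x y : uniq s -> uniq t -> supp s x -> supp t x ->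
  ip s x y = ip t x y.
Proof.
move=> us ut xs xt; apply: big_uniq_support => // k.
  by move=> /xs ->; rewrite mul0r.
by move=> /xt ->; rewrite mul0r.
Qed.

(** Young's inequality, from [c^-1 |c x - y|^2 >= 0] summed over [s]. *)
Lemma Re_ip_le s x y (c : R) : 0 < c ->
  2 * Re (ip s x y) <= c * sqs s x + c^-1 * sqs s y.
Proof.
move=> c0; rewrite Re_ip /sqs !mulr_sumr -big_split /=.
apply: ler_sum => k _; rewrite !sqr_normcE -subr_ge0.
case: (x k) (y k) => [u v] [p q] /=.
have -> : c * (u * u - v * - v) + c^-1 * (p * p - q * - q) -
    2 * (u * p - v * - q) = c^-1 * ((c * u - p) ^+ 2 + (c * v - q) ^+ 2).
  by field; rewrite gt_eqF.
by apply: mulr_ge0; [rewrite invr_ge0 ltW|rewrite addr_ge0 ?sqr_ge0].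
Qed.

Lemma sqsB s x y (c : R) : sqs s (fun k => x k - (c%:C)%C * y k) =
  sqs s x - 2 * c * Re (ip s x y) + c ^+ 2 * sqs s y.
Proof.
rewrite Re_ip /sqs !mulr_sumr -sumrN -!big_split /=.
apply: eq_bigr => k _; rewrite !sqr_normcE.
by case: (x k) (y k) => [u v] [p q] /=; ring.
Qed.

Lemma ip_adjmx N B s x y : banded N B -> uniq s -> supp s x ->
  ip (fatten N s) (mxop B x) y = ip s x (mxop (adjmx B) y).
Proof.
move=> BN us xs; rewrite /ip [RHS]big_seq.
under [RHS]eq_bigr => l ls.
  rewrite (mxop_fatten _ (adjmx_banded BN) ls) rmorph_sum mulr_sumr.
  over.
rewrite -[RHS]big_seq.
under [LHS]eq_bigr => k _ do rewrite (mxop_supp _ _ us xs) mulr_suml.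
rewrite exchange_big /=; apply: eq_bigr => l _; apply: eq_bigr => k _.
by rewrite /adjmx rmorphM /= conjcK; ring.
Qed.

(** With [v = B^* y], Young's inequality of weight [M^-2] gives [2 |v|^2 = 2 Re <B v, y> <= M^-2 |B
    v|^2 + M^2 |y|^2 <= |v|^2 + M^2 |y|^2]. *)
Lemma adjmx_op_le N B (M : R) : 0 < M -> banded N B ->
  op_le M (mxop B) -> op_le M (mxop (adjmx B)).
Proof.
move=> M0 BN BM; apply: (@band_op_le_supp N); first exact: ltW.
  by exists (adjmx B) => //; exact: adjmx_banded.
move=> s y us ys; set u := fatten N s; set v := mxop _ y.
have uu : uniq u := fatten_uniq N s.
have vu : supp u v := supp_mxop (adjmx_banded BN) ys.
have ut : uniq (fatten N u) := fatten_uniq N u.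
have := @Re_ip_le (fatten N u) (mxop B v) y (M ^- 2).
rewrite invr_gt0 exprn_gt0 // invrK => /(_ isT).
rewrite (ip_adjmx _ BN uu vu) Re_ipxx.
have Bv : sqs (fatten N u) (mxop B v) <= M ^+ 2 * sqs u v.
  have := BM v _ (sqrtr_ge0 _) (l2_le_supp uu vu).
  by move=> /(_ _ ut); rewrite exprMn sqr_sqrtr ?sqs_ge0.
have yt := sqs_le_supp us ut ys.
have H1 : M ^- 2 * sqs (fatten N u) (mxop B v) <= sqs u v.
  by rewrite mulrC ler_pdivrMr ?exprn_gt0 // mulrC.
have H2 : M ^+ 2 * sqs (fatten N u) y <= M ^+ 2 * sqs s y.
  by rewrite ler_wpM2l // sqr_ge0.
lra.
Qed.

(** * The contraction [1 - c B^*B] and its Neumann sums *)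

Definition gram_residual (c : R) B x : zseq R :=
  fun k => x k - (c%:C)%C * mxop (adjmx B) (mxop B x) k.

Lemma gram_residual_band N B (c : R) : banded N B ->
  band_op (N + N) (gram_residual c B).
Proof.
move=> BN; have Bop : band_op N (mxop B) by exists B.
have Aop : band_op N (mxop (adjmx B)) by exists (adjmx B) => //; exact: adjmx_banded.
have := band_op_axpy (- (c%:C)%C) (band_op_comp Aop Bop)
  (band_opW (leq0n _) band_op_id).
by congr band_op; apply/funext => x; apply/funext => k; rewrite mulNr addrC.
Qed.

(* With [c = M^-2] one has
   |x - c B^*B x|^2 = |x|^2 - 2c|Bx|^2 + c^2|B^*Bx|^2 <= |x|^2 - c|Bx|^2. *)
Lemma gram_residual_op_le N B (M L q : R) : 0 < M -> 0 < L -> 0 <= q ->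
  banded N B -> op_le M (mxop B) ->
  (forall s x, uniq s -> supp s x -> sqs s x <= L * sqs (fatten N s) (mxop B x)) ->
  1 - M ^- 2 / L <= q ^+ 2 ->
  op_le q (gram_residual (M ^- 2) B).
Proof.
move=> M0 L0 q0 BN BM low qL; set c := M ^- 2.
have c0 : 0 < c by rewrite invr_gt0 exprn_gt0.
apply: (band_op_le_supp q0 (gram_residual_band c BN)) => s x us xs.
set g := mxop (adjmx B) (mxop B x); set t := fatten (N + N) s.
have ut : uniq t := fatten_uniq _ _.
have uN : uniq (fatten N s) := fatten_uniq _ _.
have xt : supp t x.
  by move=> k kt; apply: xs; apply: contra kt => ks; apply: (mem_fatten ks); lia.
rewrite sqsB.
have -> : Re (ip t x g) = sqs (fatten N s) (mxop B x).
  by rewrite (ip_supp g ut us xt xs) -(ip_adjmx _ BN us xs) Re_ipxx.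
set b := sqs (fatten N s) (mxop B x).
have Bs := supp_mxop BN xs.
have gb : sqs t g <= M ^+ 2 * b.
  have := adjmx_op_le M0 BN BM (sqrtr_ge0 _) (l2_le_supp uN Bs) ut.
  by rewrite exprMn sqr_sqrtr ?sqs_ge0.
have xst : sqs t x = sqs s x by exact: sqs_supp.
have H1 : c ^+ 2 * sqs t g <= c * b.
  have -> : c * b = c ^+ 2 * (M ^+ 2 * b) by rewrite /c; field; rewrite gt_eqF.
  by rewrite ler_wpM2l ?sqr_ge0.
(* The lower bound on [B] turns the gain [c * b] into a fixed fraction [c / L] of [sqs s x]. *)
have H2 : c / L * sqs s x <= c * b.
  rewrite -mulrA ler_wpM2l ?(ltW c0) // mulrC ler_pdivrMr // mulrC.
  exact: low.
have H3 : (1 - c / L) * sqs s x <= q ^+ 2 * sqs s x.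
  by rewrite ler_wpM2r ?sqs_ge0.
rewrite xst; lra.
Qed.

Lemma iter_op_le (q : R) T m : 0 <= q -> op_le q T -> op_le (q ^+ m) (iter m T).
Proof.
move=> q0 Tq; elim: m => [|m IH] x a a0 xa; first by rewrite expr0 mul1r.
rewrite iterS exprS -mulrA; apply: Tq; last exact: IH.
by rewrite mulr_ge0 ?exprn_ge0.
Qed.

(* The partial sums [c * sum_(i < m) (1 - c B^*B)^i B^*] of the Neumann series
   of [(B^*B)^-1 B^*]. *)
Fixpoint neumann (c : R) B (m : nat) x : zseq R :=
  if m is m'.+1 then
    fun k => (c%:C)%C * mxop (adjmx B) x k + gram_residual c B (neumann c B m' x) k
  else fun=> 0.

Lemma neumann_band N B (c : R) m : banded N B ->
  exists n, band_op n (neumann c B m).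
Proof.
move=> BN; elim: m => [|m [n IH]].
  exists 0%N, (fun _ _ => 0) => //; apply/funext => x; apply/funext => k.
  by rewrite mxop_eq0 // => l; rewrite mul0r.
exists (maxn N (N + N + n)); apply: band_op_axpy.
  by apply: (band_opW (leq_maxl _ _)); exists (adjmx B) => //; exact: adjmx_banded.
apply: (band_opW (leq_maxr _ _)).
exact: (band_op_comp (gram_residual_band c BN) IH).
Qed.

(** Telescoping: with [E = 1 - c B^*B], the induction step reads
    [c B^*B + E (1 - E^m) = 1 - E^(m+1)]. *)
Lemma neumannK N B (c : R) m x : banded N B ->
  neumann c B m (mxop B x) = fun k => x k - iter m (gram_residual c B) x k.
Proof.
move=> BN; elim: m => [|m IH] /=; apply/funext => k; first by rewrite subrr.
rewrite IH (band_op_sub _ _ (gram_residual_band c BN)) [gram_residual _ _ x k]/gram_residual.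
by ring.
Qed.

(** The constant is the fixed point of [t |-> c M + q t], hence a bound uniform in [m]. *)
Lemma neumann_op_le B (c M q : R) m : 0 <= c -> 0 <= M -> 0 <= q < 1 ->
  op_le M (mxop (adjmx B)) -> op_le q (gram_residual c B) ->
  op_le (c * M / (1 - q)) (neumann c B m).
Proof.
move=> c0 M0 /andP[q0 q1] BM Eq; set b := c * M / (1 - q).
have b0 : 0 <= b by rewrite divr_ge0 ?mulr_ge0 // subr_ge0 ltW.
have bE : b = c * M + q * b by rewrite /b; field; lra.
elim: m => [|m IH] x a a0 xa /=; first exact: l2_le_cst0.
rewrite {1}bE mulrDl; apply: l2_leD.
- by rewrite mulr_ge0 // mulr_ge0.
- by rewrite mulr_ge0 // mulr_ge0.
- by have := l2_leZ (c%:C)%C (BM _ _ a0 xa); rewrite normc_real // mulrA.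
- by rewrite -mulrA; apply: Eq; [exact: mulr_ge0|exact: IH].
Qed.

(** * Banded left parametrix and improvement of an approximate inverse *)

Lemma exprn_small (q e : R) : 0 <= q < 1 -> 0 < e -> exists m, q ^+ m <= e.
Proof.
move=> /andP[q0 q1] e0.
have q1' : `|q| < 1 by rewrite ger0_norm.
have [m _ /(_ m (leqnn m)) H] := (@cvgrPdist_le _ _ _ _ _ _ _).1 (cvg_expr q1') e e0.
by exists m; move: H; rewrite /= sub0r normrN ger0_norm ?exprn_ge0.
Qed.

(* For banded [B] close to [T], [B] is bounded below on finitely supported
   sequences, so [1 - c B^*B] is a strict contraction, and the partial Neumann
   sums [D] satisfy [D B = 1 - (1 - c B^*B)^m]. *)
Lemma banded_left_parametrix T S (a s : R) : 0 <= a -> 1 <= s ->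
  op_le a T -> op_le s S -> (forall x, l2 x -> S (T x) = x) ->
  (forall e : R, 0 < e -> exists N B, banded N B /\
     op_le e (fun x k => T x k - mxop B x k)) ->
  forall eta : R, 0 < eta -> exists n (D : zseq R -> zseq R) b,
    [/\ band_op n D, 0 <= b, op_le b D & op_le eta (fun x k => x k - D (T x) k)].
Proof.
move=> a0 s1 Ta Ss ST Tapp eta eta0.
have s0 : 0 < s by lra.
(* [M] bounds every [B] within distance 1 of [T]. From [|x| <= s |T x| <= s (e |x| + |B x|)] and
   [e s <= 1/2] follows [|x| <= 2 s |B x|], whence [L]. As [M], [L], [c], [q] and [b] depend on [a]
   and [s] alone, [e] can be chosen after them and [B] after [e]. *)
pose M := a + 1; have M1 : 1 <= M by rewrite /M; lra.
have M0 : 0 < M by lra.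
pose L := (2 * s) ^+ 2; have L1 : 1 <= L by rewrite /L exprn_ege1 //; lra.
have L0 : 0 < L by lra.
pose c := M ^- 2; have c0 : 0 < c by rewrite invr_gt0 exprn_gt0.
have c1 : c <= 1 by rewrite invf_le1 ?exprn_gt0 // exprn_ege1.
have cL0 : 0 < c / L by rewrite divr_gt0.
have cL1 : c / L <= 1 by rewrite ler_pdivrMr // mul1r (le_trans c1).
pose q := Num.sqrt (1 - c / L).
have q0 : 0 <= q by exact: sqrtr_ge0.
have q2 : q ^+ 2 = 1 - c / L by rewrite sqr_sqrtr // subr_ge0.
have q1 : q < 1 by rewrite -(@ltr_pXn2r _ 2) // ?nnegrE // q2 expr1n; lra.
pose b := c * M / (1 - q).
have b0 : 0 < b by rewrite divr_gt0 ?mulr_gt0 // subr_gt0.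
(* The first term yields the lower bound on [B]; the second makes [D (T - B)] at most [eta / 2]. *)
pose e := Num.min (2 * s)^-1 (eta / 2 / b).
have e0 : 0 < e by rewrite lt_min invr_gt0 mulr_gt0 //= divr_gt0 // divr_gt0.
have es : e * s <= 2^-1.
  have H : e <= (2 * s)^-1 by rewrite ge_min lexx.
  apply: (le_trans (ler_wpM2r (ltW s0) H)).
  by rewrite invfM -mulrA mulVf ?mulr1 // gt_eqF.
have e1 : e <= 1.
  have : e * 1 <= e * s by rewrite ler_pM2l.
  lra.
have eb : b * e <= eta / 2.
  have : e <= eta / 2 / b by rewrite ge_min lexx orbT.
  by rewrite ler_pdivlMr // mulrC.
have [N [B [BN TB]]] := Tapp e e0.
have BM : op_le M (mxop B).
  move=> x u u0 xu.
  have -> : mxop B x = (fun k => T x k - (T x k - mxop B x k)).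
    by apply/funext => k; ring.
  apply: (l2_leW _ _ (l2_leB _ _ (Ta _ _ u0 xu) (TB _ _ u0 xu))).
  - by rewrite addr_ge0 ?mulr_ge0 // ltW.
  - by rewrite -mulrDl ler_wpM2r // lerD2l.
  - exact: mulr_ge0.
  - by rewrite mulr_ge0 // ltW.
have low t x : uniq t -> supp t x -> sqs t x <= L * sqs (fatten N t) (mxop B x).
  move=> ut xt; set f := fatten N t.
  have uf : uniq f := fatten_uniq _ _.
  have xu := l2_le_supp ut xt; have Bv := l2_le_supp uf (supp_mxop BN xt).
  set u := Num.sqrt (sqs t x) in xu; set v := Num.sqrt (sqs f _) in Bv.
  have u0 : 0 <= u := sqrtr_ge0 _; have v0 : 0 <= v := sqrtr_ge0 _.
  have eu0 : 0 <= e * u by rewrite mulr_ge0 // ltW.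
  have Tx : l2_le (T x) (e * u + v).
    have -> : T x = (fun k => (T x k - mxop B x k) + mxop B x k).
      by apply/funext => k; ring.
    by apply: l2_leD => //; exact: TB.
  have := Ss _ _ (addr_ge0 eu0 v0) Tx.
  rewrite ST; last by apply/l2P; exists u.
  move=> /(_ t ut) H.
  have uE : sqs t x = u ^+ 2 by rewrite sqr_sqrtr ?sqs_ge0.
  have vE : sqs f (mxop B x) = v ^+ 2 by rewrite sqr_sqrtr ?sqs_ge0.
  rewrite uE vE -exprMn in H *.
  have : u <= s * (e * u + v).
    rewrite -(@ler_pXn2r _ 2) // ?nnegrE //.
    by rewrite mulr_ge0 ?addr_ge0 // ltW.
  have : e * s * u <= 2^-1 * u by rewrite ler_wpM2r.
  move=> H1 H2; rewrite ler_pXn2r // ?nnegrE ?mulr_ge0 ?(ltW s0) //.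
  nra.
have Eq : op_le q (gram_residual c B).
  by apply: (gram_residual_op_le M0 L0 q0 BN BM low); rewrite q2.
have Am : op_le M (mxop (adjmx B)) := adjmx_op_le M0 BN BM.
have q01 : 0 <= q < 1 by rewrite q0.
have [m qm] := exprn_small q01 (divr_gt0 eta0 (ltr0n _ 2)).
have [n Dn] := neumann_band c m BN.
have Db := neumann_op_le m (ltW c0) (ltW M0) q01 Am Eq.
exists n, (neumann c B m), b; split => //; first exact: ltW.
move=> x u u0 xu.
set D := neumann c B m in Dn Db *.
(* Since [D B = 1 - E^m] with [E = 1 - c B^*B], one has [1 - D T = E^m - D (T - B)]; each term
   contributes at most [eta / 2]. *)
have -> : (fun k => x k - D (T x) k) =
    (fun k => iter m (gram_residual c B) x k - D (fun k => T x k - mxop B x k) k).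
  apply/funext => k; rewrite (band_op_sub _ _ Dn) /D (neumannK _ _ _ BN).
  by ring.
have eu0 : 0 <= e * u by rewrite mulr_ge0 // ltW.
have It := iter_op_le m q0 Eq u0 xu.
have Dt := Db _ _ eu0 (TB _ _ u0 xu).
have qu0 : 0 <= q ^+ m * u by rewrite mulr_ge0 // exprn_ge0.
have bu0 : 0 <= b * (e * u) by rewrite mulr_ge0 // ltW.
apply: (l2_leW _ _ (l2_leB qu0 bu0 It Dt)); first exact: addr_ge0.
have -> : eta = eta / 2 + eta / 2 by lra.
by rewrite mulrDl lerD // ?mulrA ler_wpM2r.
Qed.

(* [S = D + (1 - D T) S], with [T] and [S] replaced by banded approximations in
   the second term. *)
Lemma parametrix_step (T S G D X : zseq R -> zseq R) (n M : nat) (s e g b eta : R) :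
  linear_on_l2 T -> 0 <= s -> 0 <= e -> 0 <= g -> 0 <= b -> 0 <= eta ->
  op_le s S -> (forall x, l2 x -> T (S x) = x) ->
  band_op n D -> op_le b D -> op_le eta (fun x k => x k - D (T x) k) ->
  band_op M G -> op_le g (fun x k => T x k - G x k) ->
  band_op M X -> op_le s (fun x k => S x k - X x k) ->
  op_le e (fun x k => S x k - X x k) ->
  exists2 Y, band_op (n + (M + M)) Y &
    op_le (eta * e + b * g * (2 * s)) (fun x k => S x k - Y x k).
Proof.
move=> Tlin s0 e0 g0 b0 eta0 Ss TS Dn Db DT GM TG XM Xs Xe.
pose Y x : zseq R := fun k => 1 * D (fun l => x l - G (X x) l) k + X x k.
exists Y.
  have GX := band_op_comp GM XM.
  apply: band_op_axpy; last by apply: band_opW XM; lia.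
  apply: (band_op_comp Dn).
  have := band_op_axpy (- 1) GX (band_opW (leq0n _) band_op_id).
  by congr band_op; apply/funext => x; apply/funext => k; rewrite mulN1r addrC.
move=> x u u0 xu.
pose w : zseq R := fun k => S x k - X x k.
have su0 : 0 <= s * u by exact: mulr_ge0.
have ws := Xs _ _ u0 xu; have we := Xe _ _ u0 xu; rewrite -/w in ws we.
have Sx := Ss _ _ u0 xu.
have XE : X x = fun k => S x k - w k by apply/funext => k; rewrite /w; ring.
(* The crude error bound [s] controls [X] uniformly: [|X x| <= |S x| + |w| <= 2 s |x|] when [|x|] is
   at most [u]. *)
have Xx : l2_le (X x) (2 * s * u).
  by rewrite XE -mulrA mulr_natl mulr2n; exact: l2_leB.
have wl2 : l2 w by apply/l2P; exists (s * u).
have Xl2 : l2 (X x) by apply/l2P; exists (2 * s * u); rewrite // -mulrA mulr_ge0.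
have xE : x = fun k => T w k + T (X x) k.
  rewrite -[LHS]TS; last by apply/l2P; exists u.
  have -> : S x = fun k => 1 * w k + X x k by apply/funext => k; rewrite /w; ring.
  by rewrite (Tlin _ _ _ wl2 Xl2); apply/funext => k; rewrite mul1r.
(* Inserting [x = T w + T (X x)] into [Y] turns the error into [(1 - D T) w - D (T - G) (X x)]. *)
have -> : (fun k => S x k - Y x k) =
    (fun k => (w k - D (T w) k) - D (fun l => T (X x) l - G (X x) l) k).
  rewrite /Y {2}xE.
  have -> : (fun l => T w l + T (X x) l - G (X x) l) =
     (fun l => 1 * T w l + (T (X x) l - G (X x) l)) by apply/funext => l; ring.
  by rewrite (band_op_linear _ _ _ Dn); apply/funext => k; rewrite /w; ring.
have eu0 : 0 <= e * u by exact: mulr_ge0.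
have X0 : 0 <= 2 * s * u by rewrite -mulrA mulr_ge0.
have gX0 : 0 <= g * (2 * s * u) by exact: mulr_ge0.
have -> : (eta * e + b * g * (2 * s)) * u = eta * (e * u) + b * (g * (2 * s * u)).
  by ring.
apply: l2_leB; rewrite ?mulr_ge0 //; first exact: DT.
by apply: Db => //; exact: TG.
Qed.

(** * Power decay and induction on the width *)

Lemma powR_small (r C e : R) : 0 < r -> 0 < C -> 0 < e ->
  exists2 N : nat, (0 < N)%N & C * N%:R `^ (- r) <= e.
Proof.
move=> r0 C0 e0; pose v := (C / e) `^ r^-1.
exists (Num.truncn v).+1 => //; rewrite powRN.
have Ce : C / e <= (Num.truncn v).+1%:R `^ r.
  have -> : C / e = v `^ r.
    by rewrite /v -powRrM mulVf ?gt_eqF // powRr1 // divr_ge0 // ltW.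
  apply: ge0_ler_powR; rewrite ?nnegrE ?powR_ge0 ?ler0n ?(ltW r0) //.
  by apply/ltW/truncnS_gt.
rewrite ler_pdivrMr ?powR_gt0 ?ltr0n // mulrC -ler_pdivrMr //.
Qed.

Lemma powR_quarter (r : R) (N M : nat) : 0 < r -> (0 < M)%N -> (N <= 4 * M)%N ->
  (0 < N)%N -> M%:R `^ (- r) <= (4 `^ r) * N%:R `^ (- r) :> R.
Proof.
move=> r0 M0 NM N0; rewrite !powRN ler_pdivlMr ?powR_gt0 ?ltr0n //.
rewrite mulrC ler_pdivrMr ?powR_gt0 ?ltr0n // -powRM ?ler0n // -natrM.
by apply: ge0_ler_powR; rewrite ?nnegrE ?ler0n ?(ltW r0) ?ler_nat.
Qed.

Lemma inverse_band_approx (T S : zseq R -> zseq R) (G : nat -> zseq R -> zseq R)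
    (r C s : R) (n : nat) (D : zseq R -> zseq R) (b : R) :
  0 < r -> 0 < C -> 1 <= s -> linear_on_l2 T ->
  op_le s S -> (forall x, l2 x -> T (S x) = x) ->
  (forall N, (0 < N)%N -> band_op N (G N)) ->
  (forall N, (0 < N)%N ->
     op_le (C * N%:R `^ (- r)) (fun x k => T x k - G N x k)) ->
  band_op n D -> 0 <= b -> op_le b D ->
  op_le ((4 `^ r)^-1 / 2) (fun x k => x k - D (T x) k) ->
  exists2 K : R, 0 < K & forall N, (0 < N)%N ->
    exists2 X, band_op N X &
      op_le (K * N%:R `^ (- r)) (fun x k => S x k - X x k).
Proof.
move=> r0 C0 s1 Tlin Ss TS GN TG Dn b0 Db DT.
have s0 : 0 < s by lra.
have q0 : 0 < 4 `^ r :> R by rewrite powR_gt0.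
pose N0 := (2 * n + 4)%N.
pose K1 := s * N0%:R `^ r; pose K2 := 4 `^ r * 2 * (b * C * (2 * s)).
pose K := Num.max K1 K2.
have K1p : 0 < K1 by rewrite mulr_gt0 // powR_gt0 // ltr0n /N0; lia.
have K0 : 0 < K by rewrite lt_max K1p.
exists K => //.
have zero_approx : op_le s (fun x k => S x k - (fun=> 0) k).
  move=> x u u0 xu; under eq_fun do rewrite subr0; exact: Ss.
have zero_band N : band_op N (fun _ _ => 0).
  exists (fun _ _ => 0) => //; apply/funext => x; apply/funext => k.
  by rewrite mxop_eq0 // => l; rewrite mul0r.
suff H N : (0 < N)%N -> exists2 X, band_op N X &
     op_le s (fun x k => S x k - X x k) /\
     op_le (K * N%:R `^ (- r)) (fun x k => S x k - X x k).
  by move=> N /H [X XN [_ XK]]; exists X.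
elim/ltn_ind: N => N IH Np.
have [sK|Ks] := lerP s (K * N%:R `^ (- r)).
  by exists (fun _ _ => 0) => //; split => //; apply: op_leW sK zero_approx; exact: ltW.
have NN0 : (N0 < N)%N.
  rewrite ltnNge; apply/negP => NN0; move: Ks; rewrite ltNge => /negP; apply.
  rewrite powRN ler_pdivlMr ?powR_gt0 ?ltr0n //.
  apply: (@le_trans _ _ K1); last by rewrite le_max lexx.
  rewrite ler_pM2l //; apply: ge0_ler_powR; rewrite ?nnegrE ?ler0n ?(ltW r0) //.
  by rewrite ler_nat.
pose M := ((N - n)./2)%N.
have M0 : (0 < M)%N by rewrite /M; rewrite /N0 in NN0; lia.
have MN : (M < N)%N by rewrite /M; rewrite /N0 in NN0; lia.
have N4M : (N <= 4 * M)%N by rewrite /M; rewrite /N0 in NN0; lia.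
have nMN : (n + (M + M) <= N)%N by rewrite /M; rewrite /N0 in NN0; lia.
have [X XM [Xs XK]] := IH M MN M0.
have p0 : 0 <= M%:R `^ (- r) :> R := powR_ge0 _ _.
have eta0 : 0 <= (4 `^ r)^-1 / 2 :> R by rewrite divr_ge0 // invr_ge0 ltW.
have [Y YN Ye] := parametrix_step Tlin (ltW s0) (mulr_ge0 (ltW K0) p0)
  (mulr_ge0 (ltW C0) p0) b0 eta0 Ss TS Dn Db DT (GN M M0) (TG M M0) XM Xs XK.
have YK : op_le (K * N%:R `^ (- r)) (fun x k => S x k - Y x k).
  apply: op_leW Ye; first by rewrite addr_ge0 // !mulr_ge0 // ltW.
  set p := M%:R `^ (- r) in p0 *.
  have pq : (4 `^ r)^-1 * p <= N%:R `^ (- r).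
    by rewrite mulrC ler_pdivrMr // mulrC; exact: powR_quarter.
  apply: (@le_trans _ _ (K * ((4 `^ r)^-1 * p))); last by rewrite ler_pM2l.
  have K2K : (4 `^ r)^-1 / 2 * K2 <= (4 `^ r)^-1 / 2 * K.
    by rewrite ler_wpM2l // le_max lexx orbT.
  have K2E : (4 `^ r)^-1 / 2 * K2 = b * C * (2 * s).
    by rewrite /K2; field; rewrite gt_eqF.
  rewrite K2E in K2K.
  have := ler_wpM2r p0 K2K.
  lra.
exists Y; first exact: band_opW YN.
split => //; apply: op_leW YK; last exact: ltW.
by rewrite mulr_ge0 ?powR_ge0 // ltW.
Qed.

Lemma band_banded N (A : zmatrix R) : banded N (band N A).
Proof. by move=> k l kl; rewrite /band leqNgt kl. Qed.

Lemma mxop_sub_band (A : zmatrix R) N x : bounded_matrix A -> l2 x ->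
  mxop (fun k l => A k l - band N A k l) x = fun k => mxop A x k - mxop (band N A) x k.
Proof.
move=> [Acvg _] xl2; apply/funext => k.
apply: (mxop_sub (fatten_uniq N [:: k])); last exact: Acvg.
by move=> l lN; rewrite (banded_fatten (@band_banded N A) (mem_head k [::]) lN) mul0r.
Qed.

End BandedInverse.

Theorem theorem1p2 (R : realType) (A : zmatrix R) (Ainv : zseq R -> zseq R)
    (r C : R) (hr : 0 < r) (hC : 0 < C)
    (hA : l2_inverse A Ainv)
    (hband : forall N : nat, (0 < N)%N ->
       (opnorm (mxop (fun k l => A k l - band N A k l)%R) <=
          (C * N%:R `^ (- r))%:E)%E) :
  exists2 C' : R, 0 < C' &
  exists B : nat -> zmatrix R,
    (forall N : nat, (0 < N)%N -> banded N (B N)) /\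
    (forall N : nat, (0 < N)%N ->
       (opnorm (fun x k => Ainv x k - mxop (B N) x k)%R <=
          (C' * N%:R `^ (- r))%:E)%E).
Proof.
have [Abd Ainvbd AinvA AAinv] := hA.
have [_ Aop] := Abd; have [_ Alin _] := Aop.
have [a a1 Aa] := bounded_operator_op_le Aop.
have [s s1 Ss] := bounded_operator_op_le Ainvbd.
have TG N : (0 < N)%N -> op_le (C * N%:R `^ (- r))
    (fun x k => mxop A x k - mxop (band N A) x k).
  move=> N0; have e0 : 0 <= C * N%:R `^ (- r) by rewrite mulr_ge0 ?powR_ge0 // ltW.
  have H x : l2 x -> mxop (fun k l => A k l - band N A k l) x = _ :=
    mxop_sub_band N Abd (x := x).
  move=> x u u0 xu; have xl2 : l2 x by apply/l2P; exists u.
  rewrite -H //; apply: (opnorm_op_le _ e0 (hband N N0)) => //.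
  move=> c y z yl2 zl2; rewrite !H //; last first.
    have [v v0 yv] := (l2P _).1 yl2; have [w w0 zw] := (l2P _).1 zl2.
    apply/l2P; exists (Normc.normc c * v + w).
      by rewrite addr_ge0 // mulr_ge0 // normc_ge0.
    by apply: l2_leD => //; [rewrite mulr_ge0 // normc_ge0|exact: l2_leZ].
  rewrite Alin // (banded_mxopP _ _ _ (@band_banded _ N A)).
  by apply/funext => k; ring.
have [n [D [b [Dn b0 Db DT]]]] :
    exists n (D : zseq R -> zseq R) b, [/\ band_op n D, 0 <= b, op_le b D &
      op_le ((4 `^ r)^-1 / 2) (fun x k => x k - D (mxop A x) k)].
  apply: (banded_left_parametrix (le_trans ler01 a1) s1 Aa Ss AinvA).
    move=> e e0; have [N N0 Ne] := powR_small hr hC e0.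
    exists N, (band N A); split; first exact: band_banded.
    by apply: op_leW Ne (TG N N0); rewrite mulr_ge0 ?powR_ge0 // ltW.
  by rewrite divr_gt0 // invr_gt0 powR_gt0.
have GN N : (0 < N)%N -> band_op N (mxop (band N A)).
  by move=> _; exists (band N A) => //; exact: band_banded.
have [K K0 HK] := inverse_band_approx hr hC s1 Alin Ss AAinv GN TG Dn b0 Db DT.
exists K => //.
have [B HB] : {B : nat -> zmatrix R & forall N, (0 < N)%N -> banded N (B N) /\
    op_le (K * N%:R `^ (- r)) (fun x k => Ainv x k - mxop (B N) x k)}.
  apply: (@choice nat (zmatrix R) (fun N B => (0 < N)%N -> banded N B /\
    op_le (K * N%:R `^ (- r)) (fun x k => Ainv x k - mxop B x k))) => N.
  have [N0|] := boolP (0 < N)%N; last by exists (band N A).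
  by have [X [B BN ->] XK] := HK N N0; exists B.
exists B; split=> N N0; first by case: (HB N N0).
apply: op_le_opnorm; first by rewrite mulr_ge0 ?powR_ge0 // ltW.
by case: (HB N N0).
Qed.
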